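(* There exists a constant $C>0$ such that for every integer $n\ge 2$, with $D=\lceil C\log n\rceil$, every $n$-vertex graph has a non-crossing $Q_D$-obstacle representation.
   Context: Graphs are finite, simple and undirected. The $D$-cube graph $Q_D$ has vertex set $\{0,1\}^D$, with two vertices adjacent if and only if they differ in exactly one coordinate. For a graph $H$, an $H$-obstacle representation of a graph $G$ is a pair $(\varphi,S)$, where $\varphi:V(G)\to V(H)$ is injective and $S$ is a set of subsets of $V(H)$ each inducing a connected subgraph of $H$ (obstacles), such that for all distinct $u,w\in V(G)$: $uw\in E(G)$ if and only if there is a geodesic (shortest path) of $H$ from $\varphi(u)$ to $\varphi(w)$ none of whose vertices lies in $\bigcup S$. The representation is non-crossing if one can choose, for every edge $uw\in E(G)$, a shortest path $c(uw)$ of $H$ from $\varphi(u)$ to $\varphi(w)$ avoiding $\bigcup S$ in such a way that $c(uw)$ and $c(xz)$ are vertex-disjoint for all edges $uw,xz\in E(G)$ with $\{u,w\}\cap\{x,z\}=\emptyset$. *)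

(* Defs.v *)
From mathcomp Require Import all_boot.

Set Implicit Arguments.
Unset Strict Implicit.
Unset Printing Implicit Defensive.

Record sgraph := SGraph {
  vertex :> finType;
  adj : rel vertex;
  adj_sym : symmetric adj;
  adj_irrefl : irreflexive adj }.

Definition cube_adj (D : nat) : rel {ffun 'I_D -> bool} :=
  fun x y => #|[set i | x i != y i]| == 1.

Lemma cube_adj_sym (D : nat) : symmetric (@cube_adj D).
Proof.
by move=> x y; congr (_ == 1); apply: eq_card => i; rewrite !inE eq_sym.
Qed.

Lemma cube_adj_irrefl (D : nat) : irreflexive (@cube_adj D).
Proof.
move=> x; rewrite /cube_adj (_ : [set i | _] = set0) ?cards0 //.
by apply/setP => i; rewrite !inE eqxx.
Qed.

Definition cube (D : nat) : sgraph :=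
  SGraph (@cube_adj_sym D) (@cube_adj_irrefl D).

(* The subgraph induced by A is connected; the graph with no vertices is not
   counted as connected. *)
Definition induces_connected (H : sgraph) (A : {set H}) : Prop :=
  A != set0 /\
  {in A &, forall x y,
    connect [rel u v | [&& u \in A, v \in A & adj u v]] x y}.

(* s lists all the vertices of the path, both endpoints included. *)
Definition is_path (H : sgraph) (x y : H) (s : seq H) : bool :=
  if s is a :: p then [&& a == x, last a p == y, path (@adj H) a p & uniq s]
  else false.

Definition geodesic (H : sgraph) (x y : H) (s : seq H) : Prop :=
  is_path x y s /\ forall t : seq H, is_path x y t -> size s <= size t.

Definition avoids (H : sgraph) (S : {set {set H}}) (s : seq H) : Prop :=
  forall v : H, v \in s -> v \notin cover S.

Definition obstacle_representation (H G : sgraph)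
    (phi : G -> H) (S : {set {set H}}) : Prop :=
  [/\ injective phi,
      forall A : {set H}, A \in S -> induces_connected A
    & forall u w : G, u != w ->
        (adj u w <->
         exists s : seq H, geodesic (phi u) (phi w) s /\ avoids S s)].

(* A family of paths indexed by the undirected edges uw is encoded as a function
   of the ordered pair (u, w) for which the two orientations of an edge give the
   same path, traversed in opposite directions. *)
Definition noncrossing (H G : sgraph)
    (phi : G -> H) (S : {set {set H}}) : Prop :=
  exists c : G -> G -> seq H,
    [/\ forall u w : G, adj u w ->
          geodesic (phi u) (phi w) (c u w) /\ avoids S (c u w),
        forall u w : G, adj u w -> c w u = rev (c u w)
      & forall u w x z : G, adj u w -> adj x z ->
          [disjoint [set u; w] & [set x; z]] ->
          [disjoint c u w & c x z]].

Definition has_noncrossing_representation (H G : sgraph) : Prop :=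
  exists (phi : G -> H) (S : {set {set H}}),
    obstacle_representation phi S /\ noncrossing phi S.

(* Main.v *)
Require Import Defs.
From mathcomp Require Import all_boot all_order all_algebra.
From mathcomp Require Import all_classical all_reals all_analysis.
From mathcomp Require Import zify.

(** Give the vertices binary codes of length L = O(log n) such that for x outside
    {u, w} some bit of x differs from a common bit of u and w; derandomized choice
    of the bits yields such codes, since a random bit works for a given triple with
    probability at least 1/4. Send a vertex to the periodic repetition of its code
    up to length D >= 4 L, join u to w by changing the coordinates from left to
    right, and let every vertex of the cube on none of the paths of the edges be a
    one-point obstacle. Any window of L consecutive coordinates shows a whole code.
    A common point of two paths, cut at k <= k' into pieces coming from their
    endpoints, has such a window inside one of the three pieces delimited by k and
    k', so the two edges share an endpoint. If u and w are not adjacent, a point of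
    an allowed path that lies on a geodesic from u to w must be cut within L of one
    end, hence differs from u or from w at most as much as u and w differ in one
    period; a geodesic between them, at least four times as long, cannot consist of
    such points only. *)

Set Implicit Arguments.
Unset Strict Implicit.
Unset Printing Implicit Defensive.

Import Order.TTheory GRing.Theory Num.Theory.

(** * Hamming distance, left-to-right paths and geodesics of the cube *)

Definition hamming D (x y : {ffun 'I_D -> bool}) : nat :=
  #|[set i | x i != y i]|.

Lemma hamming_sym D (x y : {ffun 'I_D -> bool}) : hamming x y = hamming y x.
Proof. by apply: eq_card => i; rewrite !inE eq_sym. Qed.

Lemma hammingxx D (x : {ffun 'I_D -> bool}) : hamming x x = 0.
Proof. by apply: eq_card0 => i; rewrite !inE eqxx. Qed.

Lemma hamming_triangle D (y x z : {ffun 'I_D -> bool}) :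
  hamming x z <= hamming x y + hamming y z.
Proof.
apply: leq_trans (leq_card_setU _ _); apply/subset_leq_card/fintype.subsetP => i.
by rewrite !inE; case: (x i) (y i) (z i) => [] [] [].
Qed.

(** A coordinate where [y] leaves the common value of [x] and [z] is counted in both distances, so
    inclusion-exclusion makes the detour through [y] strictly longer. *)
Lemma hamming_between D (x y z : {ffun 'I_D -> bool}) (i : 'I_D) :
  hamming x y + hamming y z <= hamming x z -> x i = z i -> y i = x i.
Proof.
move=> le_xyz eq_xz; apply/eqP/negPn/negP => ne_yx.
move: le_xyz; rewrite leqNgt /hamming -cardsUI => /negP; apply.
rewrite -addn1; apply: leq_add.
  apply/subset_leq_card/fintype.subsetP => j.
  by rewrite !inE; case: (x j) (y j) (z j) => [] [] [].
by rewrite card_gt0; apply/set0Pn; exists i; rewrite !inE -eq_xz eq_sym ne_yx.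
Qed.

Lemma hamming_walk D (x : {ffun 'I_D -> bool}) p :
  path (@cube_adj D) x p -> hamming x (last x p) <= size p.
Proof.
elim: p x => [|y p IHp] x /=; first by rewrite hammingxx.
case/andP=> /eqP xy1 /IHp le_yp.
apply: leq_trans (hamming_triangle y _ _) _.
by rewrite {1}/hamming xy1 add1n ltnS.
Qed.

Definition splice D (x y : {ffun 'I_D -> bool}) (k : nat) : {ffun 'I_D -> bool} :=
  [ffun i : 'I_D => if i < k then y i else x i].

Lemma splice0 D (x y : {ffun 'I_D -> bool}) : splice x y 0 = x.
Proof. by apply/ffunP => i; rewrite ffunE. Qed.

Lemma splice_all D (x y : {ffun 'I_D -> bool}) : splice x y D = y.
Proof. by apply/ffunP => i; rewrite ffunE ltn_ord. Qed.

Lemma hamming_spliceS D (x y : {ffun 'I_D -> bool}) k :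
  k < D -> splice x y k != splice x y k.+1 ->
  hamming (splice x y k) (splice x y k.+1) = 1 /\
  hamming x (splice x y k.+1) = (hamming x (splice x y k)).+1.
Proof.
move=> lt_kD ne_k; pose o := Ordinal lt_kD.
have ne_o : x o != y o.
  apply: contraNN ne_k => /eqP eq_o; apply/eqP/ffunP => i; rewrite !ffunE ltnS.
  case: (ltngtP i k) => // eq_ik.
  by have -> : i = o by apply/val_inj.
split.
  rewrite /hamming (_ : [set i | _] = [set o]) ?cards1 //.
  apply/setP => i; rewrite !inE !ffunE ltnS -val_eqE /=.
  case: (ltngtP i k) => [_|_|eq_ik]; rewrite ?eqxx //.
  by have -> : i = o by apply/val_inj.
rewrite /hamming [RHS](_ : _ = #|o |: [set i | x i != splice x y k i]|).
  apply: eq_card => i; rewrite !inE !ffunE ltnS -val_eqE /=.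
  case: (ltngtP i k) => // eq_ik.
  by have -> : i = o by apply/val_inj.
by rewrite cardsU1 !inE !ffunE ltnn eqxx.
Qed.

(** Where [x] and [y] agree at [k] the splice does not move and the walk is not extended, so its
    length counts actual changes only. *)
Lemma splice_walk D (x y : {ffun 'I_D -> bool}) k : k <= D ->
  exists p, [/\ path (@cube_adj D) x p, last x p = splice x y k,
    size p = hamming x (splice x y k)
    & {in p, forall v, exists2 j, j <= D & v = splice x y j}].
Proof.
elim: k => [_|k IHk lt_kD]; first by exists [::]; rewrite splice0 hammingxx.
have [p [xp lastp sizep inp]] := IHk (ltnW lt_kD).
have [eq_k|ne_k] := eqVneq (splice x y k) (splice x y k.+1).
  by exists p; rewrite -eq_k.
have [d1 dS] := hamming_spliceS lt_kD ne_k.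
exists (rcons p (splice x y k.+1)).
rewrite rcons_path last_rcons size_rcons xp lastp /cube_adj -/(hamming _ _) d1 dS.
split=> //; first by rewrite sizep.
by move=> v; rewrite mem_rcons inE => /orP[/eqP ->|/inp //]; exists k.+1.
Qed.

(** Each step changes one coordinate, so no path beats the Hamming distance; the successor counts
    the starting vertex. *)
Lemma short_path_geodesic D (x y : cube D) (s : seq (cube D)) :
  is_path x y s -> size s <= (hamming x y).+1 -> geodesic x y s.
Proof.
move=> sP le_s; split=> // [] [|a t] //= /and4P[/eqP -> /eqP lastt walk_t _].
by apply: leq_trans le_s _; rewrite ltnS -lastt; apply: hamming_walk.
Qed.

Lemma splice_geodesic D (x y : cube D) :
  exists s : seq (cube D), [/\ geodesic x y s, size s = (hamming x y).+1
    & {in s, forall v, exists2 k, k <= D & v = splice x y k}].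
Proof.
have [p [walk_p lastp sizep inp]] := splice_walk x y (leqnn D).
rewrite splice_all in lastp sizep; move: lastp sizep.
(* Shortening supplies the distinct vertices that [is_path] demands; the length cannot drop, being
   minimal already. *)
case: (shortenP walk_p) => q walk_q uniq_q sub_qp lastq sizep.
have le_q : size q <= hamming x y.
  rewrite -sizep; apply: (@uniq_leq_size _ q p); last by [].
  by case/andP: uniq_q.
have qP : is_path x y (x :: q) by rewrite /= eqxx lastq eqxx walk_q.
exists (x :: q); split; first exact: short_path_geodesic.
  by apply/eqP; rewrite eqn_leq !ltnS le_q -lastq hamming_walk.
move=> v; rewrite inE => /orP[/eqP ->|/sub_qp/inp //].
by exists 0; rewrite ?splice0.
Qed.

Lemma geodesic_size D (x y : cube D) (s : seq (cube D)) :
  geodesic x y s -> size s <= (hamming x y).+1.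
Proof.
by case=> _ min_s; have [t [[tP _] <- _]] := splice_geodesic x y; apply: min_s.
Qed.

Lemma geodesic_rev D (x y : cube D) (s : seq (cube D)) :
  geodesic x y s -> geodesic y x (rev s).
Proof.
move=> sG; have := geodesic_size sG; case: sG => sP _ le_s.
apply: short_path_geodesic; last by rewrite size_rev hamming_sym.
case: s sP {le_s} => // a p /and4P[/eqP -> /eqP <- walk_p].
rewrite -rev_uniq lastI rev_rcons => uniq_p; apply/and4P; split=> //.
  by case: (p) => [|b q] //=; rewrite rev_cons last_rcons.
rewrite rev_path; under eq_path do rewrite /= cube_adj_sym.
exact: walk_p.
Qed.

Lemma geodesic_point D (x y : cube D) (s : seq (cube D)) j :
  geodesic x y s -> j <= hamming x y ->
  exists2 v, v \in s & hamming x v = j /\ hamming v y = hamming x y - j.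
Proof.
move=> sG; have := geodesic_size sG; case: sG => sP _.
case: s sP => //= a p /and4P[/eqP -> /eqP lastp walk_p _]; rewrite ltnS => le_p le_j.
move: walk_p lastp; rewrite -{1 2}(cat_take_drop j p) cat_path last_cat.
set v := last x (take j p) => /andP[/hamming_walk walk1 /hamming_walk walk2] lastv.
exists v.
  rewrite -(cat_take_drop j p) -cat_cons mem_cat; apply/orP; left.
  exact: mem_last.
(* The two pieces of the walk bound both distances from above; the triangle inequality turns the
   bounds into equalities. *)
have := hamming_triangle v x y; move: walk1 walk2.
rewrite lastv -/v size_drop size_take_min; lia.
Qed.

(** * Separating codes, by averaging over all choices of a bit *)

Definition separates (V : Type) (f : V -> bool) (t : V * V * V) : bool :=
  (f t.1.1 != f t.1.2) && (f t.1.2 == f t.2).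

Definition flip (V : finType) (y : V) (f : {ffun V -> bool}) : {ffun V -> bool} :=
  [ffun v => f v (+) (v == y)].

Lemma flip_inj (V : finType) (y : V) : injective (flip y).
Proof.
by apply: can_inj (flip y) _ => f; apply/ffunP => v; rewrite !ffunE addbK.
Qed.

(* Up to a factor 1/2 each, flipping f at w gives f u = f w, and then flipping f
   at x gives f x != f u; u = w is allowed. *)
Lemma separates_quarter (V : finType) (x u w : V) : x != u -> x != w ->
  2 ^ #|V| <= 4 * #|[set f : {ffun V -> bool} | separates f (x, u, w)]|.
Proof.
move=> /negPf ne_xu /negPf ne_xw; pose F := {ffun V -> bool}.
pose A := [set f : F | f u == f w].
have le_total : 2 ^ #|V| <= 2 * #|A|.
  have <- : #|{: F}| = 2 ^ #|V| by rewrite card_ffun card_bool.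
  rewrite -(cardsC A) mul2n -addnn leq_add2l -(card_imset _ (@flip_inj V w)).
  apply/subset_leq_card/fintype.subsetP => _ /imsetP[f + ->]; rewrite !inE !ffunE eqxx.
  by case: (eqVneq u w) => [->|_]; rewrite ?eqxx //; case: (f u) (f w) => [] [].
apply: leq_trans le_total _; rewrite -(mulnA 2 2) leq_mul2l /=.
rewrite -(cardsID [set f : F | f x != f u] A) mul2n -addnn leq_add //.
  by apply/subset_leq_card/fintype.subsetP => f; rewrite !inE /separates /= andbC.
rewrite -(card_imset _ (@flip_inj V x)).
apply/subset_leq_card/fintype.subsetP => _ /imsetP[f + ->].
rewrite !inE negbK /separates /= !ffunE eqxx ![_ == x]eq_sym ne_xu ne_xw.
by case: (f x) (f u) (f w) => [] [] [].
Qed.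

Definition separable (V : eqType) (t : V * V * V) : bool :=
  (t.1.1 != t.1.2) && (t.1.1 != t.2).

(** If every [f] separated less than a quarter of [T], counting the pairs [(f, t)] in two ways would
    contradict [separates_quarter]. *)
Lemma separating_function (V : finType) (T : {set V * V * V}) :
  {in T, forall t, separable t} ->
  exists f : {ffun V -> bool}, 4 * #|[set t in T | ~~ separates f t]| <= 3 * #|T|.
Proof.
move=> sepT; pose F := {ffun V -> bool}.
apply/existsP; apply: contraT; rewrite negb_exists => /forallP few.
have sat_lt (f : F) : 4 * #|[set t in T | separates f t]| < #|T|.
  have := few f; have := cardsID [set t | separates f t] T.
  rewrite -ltnNge [_ :&: _](_ : _ = [set t in T | separates f t]); last first.
    by apply/setP => t; rewrite !inE.
  rewrite [_ :\: _](_ : _ = [set t in T | ~~ separates f t]); last first.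
    by apply/setP => t; rewrite !inE andbC.
  move: #|T| #|[set t in T | separates f t]| #|[set t in T | ~~ _]|; lia.
have cardF : #|{: F}| = 2 ^ #|V| by rewrite card_ffun card_bool.
have swap : \sum_(f : F) #|[set t in T | separates f t]|
    = \sum_(t in T) #|[set f : F | separates f t]|.
  under [LHS]eq_bigr do rewrite -sum1dep_card big_mkcondr.
  rewrite exchange_big; apply: eq_bigr => t _ /=.
  by rewrite -sum1dep_card [RHS]big_mkcond.
(* The successor records the strictness of [sat_lt]; summed over [f] it leaves the positive excess
   [2 ^ #|V|]. *)
have upper : \sum_(f : F) (4 * #|[set t in T | separates f t]|).+1
    <= 2 ^ #|V| * #|T|.
  by rewrite -cardF -sum_nat_const; apply: leq_sum => f _; apply: sat_lt.
have lower : #|T| * 2 ^ #|V| <= 4 * \sum_(t in T) #|[set f : F | separates f t]|.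
  rewrite -sum_nat_const big_distrr; apply: leq_sum => -[[x u] w] /sepT.
  by case/andP=> /= ne_xu ne_xw; apply: separates_quarter.
move: upper; under eq_bigr do rewrite -addn1.
rewrite big_split -big_distrr swap sum1_card cardF /=.
rewrite [2 ^ _ * _]mulnC => /leq_trans /(_ lower).
by rewrite -[X in _ <= X]addn0 leq_add2l leqNgt expn_gt0.
Qed.

(** Each new function leaves at most 3/4 of the remaining triples unseparated, so after [L] rounds
    fewer than one is left. *)
Lemma separating_sequence (V : finType) (L : nat) (T : {set V * V * V}) :
  {in T, forall t, separable t} -> #|T| * 3 ^ L < 4 ^ L ->
  exists c : nat -> V -> bool,
    {in T, forall t, exists2 i, i < L & separates (c i) t}.
Proof.
elim: L T => [|L IHL] T sepT ltT.
  exists (fun _ _ => true) => t tT; move: ltT; rewrite (cardsD1 t) tT.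
  by rewrite !expn0 muln1.
have [f le_f] := separating_function sepT.
have [||c cP] := IHL [set t in T | ~~ separates f t].
- by move=> t; rewrite inE => /andP[/sepT].
- have pos3 : 0 < 3 ^ L by rewrite expn_gt0.
  rewrite -(ltn_pmul2l (isT : 0 < 4)) -expnS mulnA.
  apply: leq_ltn_trans ltT; rewrite expnS mulnA [_ * 3]mulnC.
  by rewrite leq_pmul2r.
exists (fun i => if i is j.+1 then c j else fun v => f v) => t tT.
case sep_f: (separates f t); first by exists 0.
have [|i lt_i sep_i] := cP t; first by rewrite inE tT sep_f.
by exists i.+1.
Qed.

Lemma separating_code (V : finType) (k : nat) : 0 < k -> #|V| <= 2 ^ k ->
  exists c : nat -> V -> bool, forall x u w : V, x != u -> x != w ->
    exists2 i, i < 8 * k & separates (c i) (x, u, w).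
Proof.
move=> k_gt0 leV.
have [||c cP] := @separating_sequence V (8 * k) [set t | separable t].
- by move=> t; rewrite inE.
- have leT : #|[set t : V * V * V | separable t]| <= (2 ^ 3) ^ k.
    apply: leq_trans (max_card _) _; rewrite !card_prod -expnM (mulnC 3) expnM.
    by rewrite -[3]/(1 + 1 + 1) !expnD expn1 !leq_mul.
  (* 8 * 3 ^ 8 < 4 ^ 8 *)
  apply: leq_ltn_trans (leq_mul leT (leqnn _)) _.
  by rewrite (expnM 3 8) (expnM 4 8) -expnMn ltn_exp2r.
by exists c => x u w ne_xu ne_xw; apply: cP; rewrite inE /separable /= ne_xu.
Qed.

(** Moving the window one step drops [P a] and adds [P (a + L)], which are equal. *)
Lemma count_window (P : pred nat) (L a : nat) :
  (forall i, P (i + L) = P i) -> count P (iota a L) = count P (iota 0 L).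
Proof.
move=> perP; elim: a => // a <-; apply: (@addnI (P a)).
rewrite -[LHS]/(count P (iota a L.+1)) -addn1 iotaD count_cat /= perP.
by rewrite addn0 addnC.
Qed.

Lemma card_ord_count (P : pred nat) (D : nat) :
  #|[set i : 'I_D | P i]| = count P (iota 0 D).
Proof.
rewrite -val_enum_ord count_map -size_filter enumT cardE; congr size.
by apply: eq_filter => i; rewrite /= inE.
Qed.

(** * The representation given by a periodic separating code *)

Section Representation.

Variables (G : sgraph) (D L : nat) (E : G -> nat -> bool).
Hypothesis periodic_E : forall x i, E x (i + L) = E x i.
Hypothesis separating_E : forall a x u w, x != u -> x != w ->
  exists i, [/\ a <= i < a + L, E x i != E u i & E u i = E w i].
Hypothesis leLD : 4 * L <= D.

Let word (x : G) : cube D := [ffun i : 'I_D => E x i].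
Let mix (x y : G) := @splice D (word x) (word y).

(** This is the case [w = u] of [separating_E]. *)
Let window_inj a x u : (forall i, a <= i < a + L -> E x i = E u i) -> x = u.
Proof.
move=> eq_xu; apply/eqP; apply: contraT => ne_xu.
have [i [/eq_xu -> ]] := separating_E a ne_xu ne_xu.
by rewrite eqxx.
Qed.

Let word_inj : injective word.
Proof.
move=> x u eq_xu; apply: (@window_inj 0) => i lt_i.
have lt_iD : i < D by lia.
by move/ffunP/(_ (Ordinal lt_iD)): eq_xu; rewrite !ffunE.
Qed.

(* If a window of length L lies left of both cuts the endpoints w, w' agree, if
   it lies right of both then u, u' agree, and between the cuts u and w' do. *)
Let mix_common u w u' w' k k' : k <= k' -> k' <= D ->
  mix u w k = mix u' w' k' -> [|| u == u', w == w' | u == w'].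
Proof.
move=> le_kk' le_k'D /ffunP eq_mix.
have eqE i : i < D -> (if i < k then E w i else E u i) =
                      (if i < k' then E w' i else E u' i).
  by move=> lt_iD; have := eq_mix (Ordinal lt_iD); rewrite !ffunE.
have [le_Lk|lt_kL] := leqP L k.
  have -> : w = w'; last by rewrite eqxx orbT.
  apply: (@window_inj 0) => i lt_i; have := eqE i.
  by rewrite !ifT; [apply; lia|lia|lia].
have [le_k'L|lt_Lk'] := leqP (k' + L) D.
  have -> : u = u'; last by rewrite eqxx.
  apply: (@window_inj k') => i lt_i; have := eqE i.
  by rewrite !ifF; [apply; lia|lia|lia].
have -> : u = w'; last by rewrite eqxx !orbT.
apply: (@window_inj k) => i lt_i; have := eqE i.
by rewrite ifF ?ifT; [apply; lia|lia|lia].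
Qed.

Let mix_disjoint u w u' w' k k' : k <= D -> k' <= D ->
  [disjoint [set u; w] & [set u'; w']] -> mix u w k <> mix u' w' k'.
Proof.
move=> le_kD le_k'D dis eq_mix.
have := disjointFr dis (set21 u w); have := disjointFr dis (set22 u w).
rewrite !inE => /norP[ne_wu' ne_ww'] /norP[ne_uu' ne_uw'].
have [le_kk'|/ltnW le_k'k] := leqP k k'.
  by have := mix_common le_kk' le_k'D eq_mix;
     rewrite (negPf ne_uu') (negPf ne_uw') (negPf ne_ww').
have := mix_common le_k'k le_kD (esym eq_mix).
by rewrite ![_ == u]eq_sym ![_ == w]eq_sym (negPf ne_uu') (negPf ne_wu') (negPf ne_ww').
Qed.

Let diffs u w := count (fun i => E u i != E w i) (iota 0 L).

Let diffs_window a u w : count (fun i => E u i != E w i) (iota a L) = diffs u w.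
Proof. by apply: count_window => i; rewrite !periodic_E. Qed.

Let diffs_gt0 u w : u != w -> 0 < diffs u w.
Proof.
move=> ne_uw; have [i [lt_i ne_i _]] := separating_E 0 ne_uw ne_uw.
by rewrite -has_count; apply/hasP; exists i; rewrite ?mem_iota.
Qed.

Let hamming_word u w : hamming (word u) (word w) =
  count (fun i => E u i != E w i) (iota 0 D).
Proof. by rewrite -card_ord_count; apply: eq_card => i; rewrite !inE !ffunE. Qed.

(** Four disjoint windows fit into a word, and by periodicity each shows [diffs u w] differences. *)
Let le_diffs_hamming u w : 4 * diffs u w <= hamming (word u) (word w).
Proof.
rewrite hamming_word -(subnKC leLD) iotaD count_cat; apply: leq_trans (leq_addr _ _).
rewrite (_ : 4 * L = L + (L + (L + L))); last by lia.
by rewrite !iotaD !count_cat !diffs_window; lia.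
Qed.

Let hamming_window a u w (v x : cube D) : a + L <= D ->
  (forall i : 'I_D, x i != v i -> a <= i < a + L /\ E u i != E w i) ->
  hamming x v <= diffs u w.
Proof.
move=> le_aD in_window.
pose P i := (a <= i < a + L) && (E u i != E w i).
apply: (@leq_trans #|[set i : 'I_D | P i]|).
  apply/subset_leq_card/fintype.subsetP => i; rewrite !inE => /in_window[].
  by rewrite /P => -> ->.
have outside b m : (b + m <= a) || (a + L <= b) -> count P (iota b m) = 0.
  move=> out; apply/eqP; rewrite -leqn0 leqNgt -has_count; apply/hasPn => i.
  by rewrite mem_iota /P; lia.
rewrite card_ord_count -(diffs_window a) (_ : D = a + (L + (D - (a + L)))); last lia.
rewrite !iotaD !count_cat (outside 0) ?leqnn // (outside (0 + a + L)); last by lia.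
by rewrite addn0 add0n; apply: sub_count => i /andP[].
Qed.

(* A point between u and w whose cut is at distance at least L from both ends
   contains a full copy of the codes of both x and z, which forces {x, z} = {u, w};
   otherwise it differs from u or w inside a single period only. *)
Let mix_between u w x z k : adj x z -> ~~ adj u w -> k <= D ->
  (forall i, word u i = word w i -> mix x z k i = word u i) ->
  hamming (word u) (mix x z k) <= diffs u w \/
  hamming (mix x z k) (word w) <= diffs u w.
Proof.
move=> adj_xz nadj_uw le_kD btw.
have btwE i : i < D -> E u i = E w i -> (if i < k then E z i else E x i) = E u i.
  by move=> lt_iD; have := btw (Ordinal lt_iD); rewrite !ffunE.
have zP : L <= k -> (z == u) || (z == w).
  move=> le_Lk; apply: contraT => /norP[ne_zu ne_zw].
  have [i [lt_i ne_i eq_i]] := separating_E 0 ne_zu ne_zw.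
  by case/eqP: ne_i; rewrite -(btwE i) ?ifT //; lia.
have xP : k + L <= D -> (x == u) || (x == w).
  move=> le_kL; apply: contraT => /norP[ne_xu ne_xw].
  have [i [lt_i ne_i eq_i]] := separating_E k ne_xu ne_xw.
  by case/eqP: ne_i; rewrite -(btwE i) ?ifF //; lia.
(* A cut before [L] leaves a full window to its right, so [x] is [u] or [w], and the point differs
   from [word x] only below [k]. *)
have [le_Lk|lt_kL] := leqP L k; last first.
  have near_x : hamming (word x) (mix x z k) <= diffs u w.
    apply: (@hamming_window 0) => [|i]; first by lia.
    rewrite !ffunE; case: ltnP => [lt_ik ne_i|]; last by rewrite eqxx.
    split; first by lia.
    apply: contraNneq ne_i => eq_i.
    have := btwE i (ltn_ord i) eq_i; rewrite lt_ik => ->.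
    have /orP[/eqP->|/eqP->] : (x == u) || (x == w) by apply: xP; lia.
      by rewrite eqxx.
    by rewrite eq_i.
  have /orP[/eqP eq_x|/eqP eq_x] : (x == u) || (x == w) by apply: xP; lia.
    by left; rewrite -{1}eq_x.
  by right; rewrite hamming_sym -{1}eq_x.
have [le_kL|lt_Lk] := leqP (k + L) D.
  case/negP: nadj_uw; have := adj_xz.
  case/orP: (zP le_Lk) => /eqP->; case/orP: (xP le_kL) => /eqP->;
    by rewrite ?adj_irrefl // adj_sym.
have near_z : hamming (word z) (mix x z k) <= diffs u w.
  (* The cut lies in the last [L] coordinates, hence so do all differences from [word z]. *)
  apply: (@hamming_window (D - L)) => [|i]; first by lia.
  have lt_iD := ltn_ord i.
  rewrite !ffunE; case: ltnP => [|le_ki ne_i]; first by rewrite eqxx.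
  split; first by lia.
  apply: contraNneq ne_i => eq_i.
  have := btwE i (ltn_ord i) eq_i; rewrite ifF; last by lia.
  move=> ->; case/orP: (zP le_Lk) => /eqP->; first by rewrite eqxx.
  by rewrite eq_i.
case/orP: (zP le_Lk) => /eqP eq_z; [left|right]; last rewrite hamming_sym.
  by rewrite -{1}eq_z.
by rewrite -{1}eq_z.
Qed.

Lemma code_representation : has_noncrossing_representation (cube D) G.
Proof.
pose spec (e : G * G) (s : seq (cube D)) := geodesic (word e.1) (word e.2) s /\
  {in s, forall v, exists2 k, k <= D & v = mix e.1 e.2 k}.
have /choice[p pP] : forall e, exists s, spec e s.
  move=> [u w].
  by have [s [? _ ?]] := splice_geodesic (word u) (word w); exists s.
(* One path per undirected edge: it starts at the endpoint of smaller rank, and the other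
   orientation is its reversal. *)
pose c u w := if enum_rank u < enum_rank w then p (u, w) else rev (p (w, u)).
have c_geo u w : geodesic (word u) (word w) (c u w).
  rewrite /c; case: ifP => _; first by have [] := pP (u, w).
  by apply: geodesic_rev; have [] := pP (w, u).
have c_mix u w v : v \in c u w ->
    exists2 k, k <= D & v = mix u w k \/ v = mix w u k.
  rewrite /c; case: ifP => _; rewrite ?mem_rev.
    by have [_ /[apply] -[k ? ?]] := pP (u, w); exists k => //; left.
  by have [_ /[apply] -[k ? ?]] := pP (w, u); exists k => //; right.
pose used v := [exists u, [exists w, adj u w && (v \in c u w)]].
pose S : {set {set cube D}} := [set [set v] | v : cube D & ~~ used v].
have coverS v : (v \in finset.cover S) = ~~ used v.
  apply/finset.bigcupP/idP => [[_ /imsetP[v' + ->]]|nv].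
    by rewrite !inE => uv' /eqP->.
  by exists [set v]; [apply: imset_f; rewrite inE|rewrite inE].
have c_avoids u w : adj u w -> avoids S (c u w).
  move=> adj_uw v v_c; rewrite coverS negbK; apply/existsP; exists u.
  by apply/existsP; exists w; rewrite adj_uw.
exists word, S; split; last first.
  exists c; split=> [u w adj_uw|u w adj_uw|u w x z adj_uw adj_xz dis].
  - by split; [apply: c_geo|apply: c_avoids].
  - rewrite /c; case: (ltngtP (enum_rank u) (enum_rank w)); rewrite ?revK //.
    by move/val_inj/enum_rank_inj => eq_uw; rewrite eq_uw adj_irrefl in adj_uw.
  - apply/pred0P => v; apply/negP => /andP[/= /c_mix[k le_kD vk] /c_mix[k' le_k'D vk']].
    case: vk vk' => -> [] eq_mix; apply: mix_disjoint eq_mix => //.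
    + by rewrite [[set z; x]]finset.setUC.
    + by rewrite [[set w; u]]finset.setUC.
    + by rewrite [[set w; u]]finset.setUC [[set z; x]]finset.setUC.
split=> [|A /imsetP[v _ ->]|u w ne_uw]; first exact: word_inj.
- split; first by apply/set0Pn; exists v; rewrite set11.
  by move=> x y /set1P-> /set1P->; apply: connect0.
split=> [adj_uw|[s [s_geo s_avoids]]].
  by exists (c u w); split; [apply: c_geo|apply: c_avoids].
apply: contraT => nadj_uw.
have pos := diffs_gt0 ne_uw; have le_diffs := le_diffs_hamming u w.
(* With [d = diffs u w], a point at distance [d + 1] from [word u] on the geodesic is at distance at
   least [3 * d - 1 > d] from [word w], so it violates both bounds of [mix_between]. *)
have [|v v_s [dist_uv dist_vw]] := geodesic_point (j := (diffs u w).+1) s_geo.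
  by lia.
have := s_avoids v v_s; rewrite coverS negbK.
case/existsP=> x /existsP[z /andP[adj_xz /c_mix[k le_kD]]].
have btw i : word u i = word w i -> v i = word u i.
  by apply: hamming_between; rewrite dist_uv dist_vw; lia.
have adj_zx : adj z x by rewrite adj_sym.
case=> eq_v; rewrite eq_v in btw dist_uv dist_vw.
  by case: (mix_between adj_xz nadj_uw le_kD btw); rewrite ?dist_uv ?dist_vw; lia.
by case: (mix_between adj_zx nadj_uw le_kD btw); rewrite ?dist_uv ?dist_vw; lia.
Qed.

End Representation.

(** * Dimension logarithmic in the number of vertices *)

Lemma log_representation (G : sgraph) (D k : nat) :
  0 < k -> #|G| <= 2 ^ k -> 32 * k <= D -> has_noncrossing_representation (cube D) G.
Proof.
move=> k_gt0 leG leD; have [c cP] := separating_code k_gt0 leG.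
apply: (@code_representation G D (8 * k) (fun x i => c (i %% (8 * k)) x)).
- by move=> x i; rewrite modnDr.
- move=> a x u w ne_xu ne_xw; have [r lt_r sep_r] := cP x u w ne_xu ne_xw.
  pose P i := separates (c (i %% (8 * k))) (x, u, w).
  (* By periodicity the separating position [r] of the first period recurs in the window starting at
     [a]. *)
  have : 0 < count P (iota a (8 * k)).
    rewrite count_window => [|i]; last by rewrite /P modnDr.
    by rewrite -has_count; apply/hasP; exists r; rewrite ?mem_iota // /P modn_small.
  rewrite -has_count => /hasP[i]; rewrite mem_iota => lt_i /andP[ne_i /eqP eq_i].
  by exists i.
- by lia.
Qed.

Local Open Scope ring_scope.

Theorem theorem26 (R : realType) :
  exists C : R, 0 < C /\
    forall n D : nat, (2 <= n)%N -> D%:Z = Num.ceil (C * ln n%:R) ->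
      forall G : sgraph, #|G| = n ->
        has_noncrossing_representation (cube D) G.
Proof.
have ln2_gt0 : 0 < ln 2 :> R by apply: ln_gt0; rewrite ltr1n.
(* With [t = trunc_log 2 n >= 1], codes of [8 * t.+1] bits need dimension [32 * t.+1 <= 64 * t];
   dividing by [ln 2] passes from binary to natural logarithms. *)
exists (64 / ln 2); split; first by rewrite divr_gt0.
move=> n D le2n eqD G cardG.
pose t := trunc_log 2 n.
have /andP[le_tn lt_nt] : (2 ^ t <= n < 2 ^ t.+1)%N by apply: trunc_log_bounds; lia.
have t_gt0 : (0 < t)%N by rewrite -ltnS -(ltn_exp2l _ _ (isT : 1 < 2)%N); lia.
have ln_n : t%:R * ln 2 <= ln n%:R :> R.
  rewrite mulr_natl -lnXn // -natrX ler_ln ?ler_nat ?posrE ?ltr0n ?expn_gt0 //.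
  exact: ltnW.
have leD : (64 * t)%:R <= D%:R :> R.
  rewrite (pmulrn 1 D) eqD; apply: le_trans (ceil_ge _).
  by rewrite natrM mulrAC ler_pdivlMr // -mulrA ler_pM2l.
apply: (@log_representation _ _ t.+1) => //; first by rewrite cardG ltnW.
by move: leD; rewrite ler_nat; lia.
Qed.
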